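(* Let $H$ be a graph with no isolated vertex. If $H$ is bipartite and not a star, then $gr_k^{*}(K_3: H)$ is linear in $k$ (i.e., bounded above and below by linear functions of $k$ with positive leading coefficients depending only on $H$). If $H$ is not bipartite, then $gr_k^{*}(K_3: H)$ is exponential in $k$ (i.e., bounded above and below by functions of the form $c^{k}$ up to constant factors, with constants $c>1$ depending only on $H$).
   Context: A $k$-edge-coloring uses colors from $[k]=\{1,\ldots,k\}$. A subgraph is monochromatic if all its edges have the same color and rainbow if no two of its edges have the same color. The Gallai-Ramsey number $gr_k(K_3: H)$ is the smallest integer $n$ such that every $k$-edge-colored $K_n$ contains either a rainbow $K_3$ or a monochromatic copy of $H$. For $n=gr_k(K_3:H)$ and $0\le s\le n-1$, $K_{n-1}\sqcup K_{1,s}$ denotes the graph obtained from $K_{n-1}$ by adding a new vertex $v$ and $s$ edges joining $v$ to $s$ vertices of $K_{n-1}$. The star-critical Gallai-Ramsey number $gr_k^{*}(K_3: H)$ is the smallest integer $s$ such that every $k$-edge-colored $K_{n-1}\sqcup K_{1,s}$ contains either a rainbow $K_3$ or a monochromatic copy of $H$. *)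

(* Defs.v *)
From mathcomp Require Import all_boot all_order all_algebra reals.

Set Implicit Arguments.
Unset Strict Implicit.
Unset Printing Implicit Defensive.

Import Order.TTheory GRing.Theory Num.Theory.

Record sgraph := SGraph {
  vertex :> finType;
  adj : rel vertex;
  adj_sym : symmetric adj;
  adj_irr : irreflexive adj }.

Definition no_isolated_vertex (G : sgraph) : Prop :=
  forall x : G, exists y : G, adj x y.

Definition bipartite (G : sgraph) : Prop :=
  exists side : G -> bool, forall x y : G, adj x y -> side x != side y.

(* G is K_{1,m} with m = #|G| - 1; for m = 1 this is a single edge. *)
Definition star (G : sgraph) : Prop :=
  exists v : G, forall x y : G,
    adj x y = (x != y) && ((x == v) || (y == v)).

Section Complete.
Variable n : nat.

Definition complete_rel : rel 'I_n := fun x y => x != y.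

Lemma complete_sym : symmetric complete_rel.
Proof. by move=> x y; rewrite /complete_rel eq_sym. Qed.

Lemma complete_irr : irreflexive complete_rel.
Proof. by move=> x; rewrite /complete_rel eqxx. Qed.

Definition complete : sgraph := SGraph complete_sym complete_irr.
End Complete.

(* K_m together with a new vertex None joined to the s vertices Some i, i < s *)
(* (to all of K_m when s >= m).                                               *)
Section CompleteStar.
Variables m s : nat.

Definition complete_star_rel : rel (option 'I_m) := fun x y =>
  match x, y with
  | Some i, Some j => i != j
  | Some i, None | None, Some i => i < s
  | None, None => false
  end.

Lemma complete_star_sym : symmetric complete_star_rel.
Proof. by case=> [i|] [j|] //=; rewrite eq_sym. Qed.

Lemma complete_star_irr : irreflexive complete_star_rel.
Proof. by case=> [i|] //=; rewrite eqxx. Qed.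

Definition complete_star : sgraph :=
  SGraph complete_star_sym complete_star_irr.
End CompleteStar.

(* A k-edge-coloring of G is given by a coloring of all sets of vertices, of  *)
(* which only the values at the edges [set x; y] are ever used.               *)
Definition coloring (k : nat) (G : sgraph) := {ffun {set G} -> 'I_k}.

Section Copies.
Variables (k : nat) (G F : sgraph) (c : coloring k G).

(* Subgraphs of G isomorphic to F (not necessarily induced) are the images of *)
(* the injective homomorphisms from F to G.                                   *)
Definition is_copy (f : {ffun F -> G}) : bool :=
  injectiveb f && [forall x, forall y, adj x y ==> adj (f x) (f y)].

Definition monochromatic (f : {ffun F -> G}) : bool :=
  [exists a, forall x, forall y, adj x y ==> (c [set f x; f y] == a)].

Definition rainbow (f : {ffun F -> G}) : bool :=
  [forall x, forall y, forall z, forall t,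
    [&& adj x y, adj z t & [set x; y] != [set z; t]] ==>
    (c [set f x; f y] != c [set f z; f t])].

Definition has_monochromatic : bool :=
  [exists f, is_copy f && monochromatic f].

Definition has_rainbow : bool :=
  [exists f, is_copy f && rainbow f].
End Copies.

Definition gallai_arrows (k : nat) (G H : sgraph) : bool :=
  [forall c : coloring k G,
    has_rainbow (complete 3) c || has_monochromatic H c].

(* Ramsey's theorem, which makes the Gallai-Ramsey numbers well defined. *)

Lemma ramsey_sequence k (V : finType) (c : {set V} -> 'I_k) L (A : {set V}) :
  k.+1 ^ L <= #|A| ->
  exists s : seq (V * 'I_k),
    [/\ size s = L, uniq (map fst s), {subset map fst s <= A} &
        pairwise (fun p q => c [set p.1; q.1] == p.2) s].
Proof.
have k_gt0 : 0 < k by apply: leq_ltn_trans (ltn_ord (c set0)).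
elim: L A => [|L IHL] A leA; first by exists [::].
have /card_gt0P[x Ax] : 0 < #|A| by apply: leq_trans leA; rewrite expn_gt0.
pose B a := [set y in A :\ x | c [set x; y] == a].
have [a leB] : exists a, k.+1 ^ L <= #|B a|.
  case: (pickP (fun a => k.+1 ^ L <= #|B a|)) => [a leB|ltB]; first by exists a.
  have sumB : \sum_a #|B a| = #|A :\ x|.
    rewrite -sum1_card (partition_big (fun y => c [set x; y]) predT) //=.
    apply: eq_bigr => a _; rewrite -sum1_card.
    by apply: eq_bigl => y; rewrite !inE.
  have : \sum_a #|B a| <= \sum_(a < k) (k.+1 ^ L).-1.
    apply: leq_sum => a _; move/negbT: (ltB a); rewrite -ltnNge.
    by case: (k.+1 ^ L).
  rewrite sumB sum_nat_const card_ord => le; exfalso.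
  move: le; apply/negP; rewrite -ltnNge.
  have : k.+1 ^ L.+1 <= (#|A :\ x|).+1.
    by move: leA; rewrite (cardsD1 x A) Ax.
  rewrite expnS mulSn; have := expn_gt0 k.+1 L.
  case: (k.+1 ^ L) => // N _; rewrite addSn ltnS /= mulnS => le1.
  apply: leq_trans le1; apply: leq_trans (leq_addl _ _).
  by rewrite -[X in X < _]add0n ltn_add2r.
have [s [szs us sB ps]] := IHL _ leB.
have inB p : p \in s -> p.1 \in B a by move=> sp; apply/sB/map_f.
exists ((x, a) :: s); split=> /=; first by rewrite szs.
- rewrite us andbT; apply/negP=> /sB.
  by rewrite !inE eqxx.
- move=> y; rewrite inE => /orP[/eqP-> //|/sB].
  by rewrite !inE -andbA => /and3P[].
- rewrite ps andbT; apply/allP=> p /inB.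
  by rewrite inE => /andP[_].
Qed.

Lemma gallai_arrows_exists k H : exists n, gallai_arrows k (complete n) H.
Proof.
exists (k.+1 ^ (k * #|H|)); set n := (X in complete X).
apply/forallP=> c; apply/orP; right.
have [|s [szs us _ ps]] := @ramsey_sequence k 'I_n c (k * #|H|) setT.
  by rewrite cardsT card_ord.
have k_gt0 : 0 < k by apply: leq_ltn_trans (ltn_ord (c set0)).
have [a leH] : exists a, #|H| <= count (fun p => p.2 == a) s.
  case: (pickP (fun a => #|H| <= count (fun p => p.2 == a) s)) => [a leH|ltH].
    by exists a.
  have sums : \sum_a count (fun p => p.2 == a) s = size s.
    elim: (s) => [|p s' IHs] /=; first by rewrite big1.
    rewrite big_split /= IHs (bigD1 p.2) //= eqxx big1 ?addn0 //.
    by move=> b; rewrite eq_sym => /negPf->.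
  have : \sum_(a < k) count (fun p => p.2 == a) s < \sum_(a < k) #|H|.
    have lt a : count (fun p : 'I_n * 'I_k => p.2 == a) s < #|H|.
      by rewrite ltnNge [X in ~~ X]ltH.
    rewrite (bigD1 (Ordinal k_gt0)) //= [X in _ < X](bigD1 (Ordinal k_gt0)) //=.
    by rewrite -addSn leq_add // leq_sum // => i _; apply: ltnW.
  by rewrite sums szs sum_nat_const card_ord ltnn.
pose t := [seq p.1 | p <- s & p.2 == a].
have szt : #|H| <= size t by rewrite size_map size_filter.
have ut : uniq t by apply: subseq_uniq us; apply/map_subseq/filter_subseq.
have pt : pairwise (fun x y => c [set x; y] == a) t.
  rewrite pairwise_map.
  have : pairwise (fun p q : 'I_n * 'I_k => c [set p.1; q.1] == p.2)
           [seq p <- s | p.2 == a].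
    exact: subseq_pairwise (filter_subseq _ _) ps.
  have /allP := filter_all (fun p : 'I_n * 'I_k => p.2 == a) s.
  elim: (filter _ s) => //= p r IHr ar /andP[/allP pr rr].
  apply/andP; split.
    apply/allP=> q rq /=; rewrite (eqP (pr q rq)).
    by rewrite ar ?mem_head.
  by apply: IHr => // q rq; rewrite ar // inE rq orbT.
have n_gt0 : 0 < n by rewrite expn_gt0.
pose x0 := Ordinal n_gt0.
have rkP (x : H) : enum_rank x < size t by apply: leq_trans szt.
pose f : {ffun H -> complete n} := [ffun x => nth x0 t (enum_rank x)].
have f_inj : injective f.
  move=> x y; rewrite !ffunE => /eqP.
  by rewrite nth_uniq ?rkP // => /eqP/val_inj/enum_rank_inj.
apply/existsP; exists f; apply/andP; split.
  apply/andP; split; first exact/injectiveP.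
  apply/forallP=> x; apply/forallP=> y; apply/implyP=> xy.
  rewrite /= /complete_rel (inj_eq f_inj).
  by apply: contraTneq xy => ->; rewrite adj_irr.
apply/existsP; exists a; apply/forallP=> x; apply/forallP=> y.
apply/implyP=> xy; move/(pairwiseP x0): pt => pt.
rewrite !ffunE.
case: (ltngtP (enum_rank x) (enum_rank y)) => [lt|lt|/val_inj/enum_rank_inj E].
- by apply: pt; rewrite ?inE ?rkP.
- by rewrite setUC; apply: pt; rewrite ?inE ?rkP.
- by rewrite E adj_irr in xy.
Qed.

Lemma gallai_arrows_sub k (G G' H : sgraph) (g : G -> G') :
  injective g -> (forall x y, adj x y -> adj (g x) (g y)) ->
  gallai_arrows k G H -> gallai_arrows k G' H.
Proof.
move=> g_inj g_adj /forallP arr; apply/forallP=> c'.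
pose c : coloring k G := [ffun e : {set G} => c' (g @: e)].
have cE x y : c [set x; y] = c' [set g x; g y].
  by rewrite ffunE imsetU !imset_set1.
have copyP (F : sgraph) (f : {ffun F -> G}) :
    is_copy f -> is_copy ([ffun x => g (f x)] : {ffun F -> G'}).
  case/andP=> /injectiveP f_inj /forallP f_adj; apply/andP; split.
    by apply/injectiveP=> x y; rewrite !ffunE => /g_inj/f_inj.
  apply/forallP=> x; apply/forallP=> y; apply/implyP=> xy.
  by rewrite !ffunE; apply/g_adj/(implyP (forallP (f_adj x) y)).
have /orP[/existsP[f /andP[cf rf]]|/existsP[f /andP[cf mf]]] := arr c.
  apply/orP; left; apply/existsP; exists [ffun x => g (f x)].
  rewrite copyP //=; apply/forallP=> x; apply/forallP=> y.
  apply/forallP=> z; apply/forallP=> t.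
  rewrite !ffunE -!cE.
  by move/forallP: rf => /(_ x)/forallP/(_ y)/forallP/(_ z)/forallP/(_ t).
apply/orP; right; apply/existsP; exists [ffun x => g (f x)].
rewrite copyP //=; have /existsP[a /forallP ma] := mf.
apply/existsP; exists a; apply/forallP=> x; apply/forallP=> y.
by rewrite !ffunE -cE; move/forallP: (ma x) => /(_ y).
Qed.

Definition gallai_ramsey (k : nat) (H : sgraph) : nat :=
  ex_minn (gallai_arrows_exists k H).

Lemma gallai_arrows_star_exists k H :
  exists s, gallai_arrows k (complete_star (gallai_ramsey k H).-1 s) H.
Proof.
rewrite /gallai_ramsey; case: ex_minnP => n arr _; exists n.-1.
pose g (i : complete n) : complete_star n.-1 n.-1 := insub (val i).
have gNone (i : 'I_n) : ~~ (i < n.-1) -> val i = n.-1.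
  move: (ltn_ord i); case: n {arr g} i => [[]//|n] i /=.
  by rewrite ltnS -leqNgt => le1 le2; apply/eqP; rewrite eqn_leq le1 le2.
have g_inj : injective g.
  move=> i j; rewrite /g; case: insubP => [u _ ui|/gNone ni];
    case: insubP => [v _ vj|/gNone nj] //.
    by case=> uv; apply: val_inj; rewrite -ui -vj uv.
  by move=> _; apply: val_inj; rewrite ni nj.
apply: (gallai_arrows_sub g_inj) arr => i j ij.
have : g i != g j by rewrite (inj_eq g_inj).
by case: (g i) (g j) => [u|] [v|] //= _; rewrite ltn_ord.
Qed.

Definition star_critical_gallai_ramsey (k : nat) (H : sgraph) : nat :=
  ex_minn (gallai_arrows_star_exists k H).

Local Open Scope ring_scope.

Definition linear_growth (R : realType) (u : nat -> nat) : Prop :=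
  exists a b a' b' : R, [/\ 0 < a, 0 < a' &
    forall k : nat, (1 <= k)%N ->
      a * k%:R + b <= (u k)%:R <= a' * k%:R + b'].

Definition exponential_growth (R : realType) (u : nat -> nat) : Prop :=
  exists a c a' c' : R, [/\ 0 < a, 1 < c, 0 < a', 1 < c' &
    forall k : nat, (1 <= k)%N ->
      a * c ^+ k <= (u k)%:R <= a' * c' ^+ k].

(* Main.v *)
Require Import Defs.
From mathcomp Require Import all_boot all_order all_algebra reals zify.

Set Implicit Arguments.
Unset Strict Implicit.
Unset Printing Implicit Defensive.

Import Order.TTheory GRing.Theory Num.Theory.

(* Let t = #|H| and m = gr_k(K_3 : H) - 1. By Gallai's theorem, the vertices  *)
(* of a coloring without rainbow triangles can be separated using two colors. *)
(* Applied inside a minimal module of size at least 2t, this yields a set T   *)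
(* of t vertices such that a proportion (depending on t only) of all vertices *)
(* is joined to T in one color each; let S be the set of these vertices. In   *)
(* an extremal coloring of K_m, a new vertex joined to S as the vertices of T *)
(* are creates no monochromatic H, so gr_k^* and gr_k grow alike. If H is     *)
(* bipartite, S has less than k t elements, since otherwise T and t vertices  *)
(* of S span a monochromatic K_{t,t}, so m is at most linear. In general,     *)
(* separation gives |A| <= 4^(sum of the clique numbers of A in all colors).  *)
(* Colorings whose classes are stars, resp. bipartite graphs, give m >= k,    *)
(* resp. m >= 2^k.                                                            *)

(** Everything is compared with [m = (gallai_ramsey k H).-1], the size of an extremal coloring. A
    full star over K_m is K_(m+1), so the star-critical number is at most [m] ([star_critical_leq]);
    conversely [m] is at most a constant depending on [H] only times the star-critical number
    ([extremal_leq_star_critical], from [homogeneous_pair] and [twin_not_arrows]). It remains to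
    bound [m]: above by [extremal_linear_leq] or [extremal_exponential_leq], both resting on
    Gallai's theorem in the form of [gallai_separation], and below by the explicit colorings of
    [linear_leq_extremal] and [exponential_leq_extremal]. *)

Section GallaiColorings.
Variables (V : finType) (K : eqType) (col : V -> V -> K).
Hypothesis colC : forall x y, col x y = col y x.
Hypothesis no_rainbow : forall x y z, x != y -> y != z -> x != z ->
  [|| col x y == col y z, col y z == col x z | col x y == col x z].

Lemma gallai_other_edges x y z : x != y -> y != z -> x != z ->
  col x y != col y z -> col x z != col y z -> col x y = col x z.
Proof.
move=> xy yz xz /negPf nxy /negPf nxz; have := no_rainbow xy yz xz.
by rewrite nxy eq_sym nxz => /eqP.
Qed.

(** Vertices of [A] in different components of this graph are joined in color [a] or [b]. The case
    [a = b] is allowed and means separation by a single color. *)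
Definition other_color (A : {set V}) (a b : K) : rel V :=
  fun x y => [&& x != y, x \in A, y \in A, col x y != a & col x y != b].

Lemma other_color_sym (A : {set V}) a b : symmetric (other_color A a b).
Proof.
by move=> x y; rewrite /other_color colC eq_sym; case: (x \in A); case: (y \in A).
Qed.

Lemma other_color_connect_sym (A : {set V}) a b :
  connect_sym (other_color A a b).
Proof. exact/sym_connect_sym/other_color_sym. Qed.

Lemma other_color_connect_in (A : {set V}) a b x y :
  x \in A -> connect (other_color A a b) x y -> y \in A.
Proof.
move=> Ax /connectP[p]; case/lastP: p => [_ -> //|p z].
by rewrite rcons_path last_rcons => /andP[_ /and5P[_ _ ? _ _]] ->.
Qed.

Lemma other_color_separated (A : {set V}) a b x z : x \in A -> z \in A ->
  ~~ connect (other_color A a b) x z -> col x z = a \/ col x z = b.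
Proof.
move=> Ax Az nxz; case: (col x z =P a) => [->|/eqP nxa]; first by left.
case: (col x z =P b) => [->|/eqP nxb]; first by right.
case/negP: nxz; apply/connectP.
have [->|nx] := eqVneq x z; first by exists [::].
by exists [:: z]; rewrite //= /other_color nx Ax Az nxa nxb.
Qed.

(** Along an edge [x u] of the graph, both [x z] and [u z] have color [a] or [b] while [x u] has
    neither, so the triangle forces the former two to agree. *)
Lemma other_color_module (A : {set V}) a b x y z : x \in A -> z \in A ->
  ~~ connect (other_color A a b) x z -> connect (other_color A a b) x y ->
  col x z = col y z.
Proof.
move=> Ax Az nxz /connectP[p]; elim: p x Ax nxz => [|u p IHp] x Ax nxz /=.
  by move=> _ ->.
case/andP=> xu pu yE; have /and5P[nxu _ Au nua nub] := xu.
have nuz : ~~ connect (other_color A a b) u z.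
  by apply: contra nxz; apply/connect_trans/connect1.
rewrite -(IHp u) //.
have nxz' : x != z by apply: contraNneq nxz => ->; rewrite connect0.
have nuz' : u != z by apply: contraNneq nuz => ->; rewrite connect0.
have := no_rainbow nxu nuz' nxz'.
have [->|->] := other_color_separated Ax Az nxz;
  have [->|->] := other_color_separated Au Az nuz => //;
  by rewrite (negPf nua) (negPf nub) orbF => /eqP->.
Qed.

(* In the induction step, a vertex x that reconnects all the components sends *)
(* a single further color c to all of them; one of the pairs {c} and {a, c}   *)
(* or {b, c} then separates either x or a whole component.                    *)
Lemma gallai_separation (A : {set V}) : 1 < #|A| ->
  exists a b, exists x y,
    [/\ x \in A, y \in A & ~~ connect (other_color A a b) x y].
Proof.
have [n] := ubnP #|A|; elim: n A => // n IHn A leA ltA.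
have /card_gt0P[x Ax] := ltnW ltA.
move: leA ltA; rewrite (cardsD1 x) Ax !add1n !ltnS.
set B := A :\ x => leA B_gt0.
have BA y : y \in B -> y \in A by case/setD1P.
have nBx y : y \in B -> x != y by rewrite eq_sym; case/setD1P.
have AB y : y \in A -> y != x -> y \in B by move=> Ay nyx; apply/setD1P.
have isolated a y : y \in B -> (forall z, z \in B -> col x z = a) ->
    ~~ connect (other_color A a a) x y.
  move=> By allx; apply/negP=> /connectP[[_ E|u p /= /andP[+ _] _]].
    by have := nBx _ By; rewrite E eqxx.
  by case/and5P=> nxu _ Au + _; rewrite allx ?eqxx // AB // eq_sym.
have [ltB|leB] := ltnP 1 #|B|; last first.
  have /cards1P[y BE] : #|B| == 1 by rewrite eqn_leq leB.
  have By : y \in B by rewrite BE inE.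
  exists (col x y), (col x y), x, y.
  split=> //; [exact: BA | apply: isolated => // z].
  by rewrite BE inE => /eqP->.
have [a [b [y0 [z0 [By0 Bz0 n0]]]]] := IHn _ leA ltB.
set e := other_color B a b in n0; pose f := connect e.
have fS y z : f y z = f z y := other_color_connect_sym B a b y z.
have fT y z w : f y z -> f z w -> f y w := fun p q => connect_trans p q.
have other y : exists2 z, z \in B & ~~ f y z.
  case fy: (f y y0); last by exists y0; rewrite ?fy.
  exists z0 => //; apply: contra n0 => fz.
  by apply: (fT _ y) => //; rewrite fS.
have fB y z : y \in B -> f y z -> z \in B := @other_color_connect_in B a b y z.
have nfn y z : ~~ f y z -> y != z.
  by apply: contraNneq => ->; apply: connect0.
have sep y z : y \in B -> z \in B -> ~~ f y z -> col y z = a \/ col y z = b.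
  exact: other_color_separated.
have mdl y y' z : y \in B -> z \in B -> ~~ f y z -> f y y' -> col y z = col y' z.
  exact: other_color_module.
have stay a' b' y : (forall w u, f y w -> u \in A ->
      col w u != a' -> col w u != b' -> f y u) ->
    forall z, connect (other_color A a' b') y z -> f y z.
  move=> cl z /connectP[p yp ->].
  suff st w : f y w -> path (other_color A a' b') w p -> f y (last w p).
    by apply: st yp; apply: connect0.
  elim: p {yp} w => //= u p IHp w fw /andP[/and5P[_ _ Au ua ub]].
  by apply: IHp; apply: cl fw Au ua ub.
case: (pickP [pred y in B | [forall z, f y z ==> (col x z \in [:: a; b])]]) =>
    [y /andP[By /forallP noy]|all_out].
  (* A component seen by [x] only in colors [a] and [b] remains a component after [x] is added. *)
  exists a, b, y, x; split=> //; first exact: BA.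
  suff: ~~ f y x.
    apply: contra; apply: stay => w u fw Au ua ub.
    have Bw := fB _ _ By fw.
    have [ux|/(AB _ Au) Bu] := eqVneq u x.
      have := implyP (noy w) fw; rewrite colC -ux !inE.
      by rewrite (negPf ua) (negPf ub).
    have [<- //|nwu] := eqVneq w u.
    by apply: fT fw _; apply: connect1; rewrite /e /other_color nwu Bw Bu ua.
  apply/negP=> /(fB _ _ By); by rewrite !inE eqxx.
have out y : y \in B -> exists z,
    [/\ z \in B, f y z, col x z != a & col x z != b].
  move=> By; have /= := all_out y; rewrite By /= => /negbT.
  rewrite negb_forall => /existsP[z]; rewrite negb_imply !inE negb_or.
  by case/and3P=> fz na nb; exists z; rewrite (fB y).
have [y1 [By1 f01 y1a y1b]] := out _ By0; set c := col x y1 in y1a y1b.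
(* The edge [y1 z] between components has color [a] or [b], which neither [x y1] nor [x z] has. *)
have far z : z \in B -> col x z != a -> col x z != b -> ~~ f y1 z ->
    col x z = c.
  move=> Bz za zb nz; apply/esym/gallai_other_edges; rewrite ?nBx ?nfn //;
    by case: (sep _ _ By1 Bz nz) => ->.
have [z1 [Bz1 fz01 z1a z1b]] := out _ Bz0.
have n1 : ~~ f y1 z1.
  apply: contra n0 => f1; apply: (fT _ _ _ f01).
  by apply: (fT _ _ _ f1); rewrite fS.
(* Inside the component of [y1], the comparison goes through [z1], which lies in another one. *)
have near z : z \in B -> col x z != a -> col x z != b -> col x z = c.
  move=> Bz za zb; have [fz|] := boolP (f y1 z); last exact: far.
  have nz : ~~ f z z1 by apply: contra n1; apply: fT fz.
  rewrite -(far z1) //; apply: gallai_other_edges; rewrite ?nBx ?nfn //;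
    by case: (sep _ _ Bz Bz1 nz) => ->.
case: (pickP [pred y in B | col x y != c]) => [y /andP[By nyc]|allc]; last first.
  exists c, c, x, y0; split=> //; [exact: BA | apply: isolated => // z Bz].
  by have := allc z; rewrite /= Bz => /negbFE/eqP.
have [z Bz nyz] := other y.
(* The component of [u] has a vertex [v] with [x v] of color [c], and [w v] is colored as [w u]. In
   the triangle [w], [x], [v] neither other edge has color [c], so they agree. *)
have key w u : w \in B -> col x w != c -> u \in B -> ~~ f w u ->
    col w u = col x w.
  move=> Bw wc Bu nwu; have [v [Bv fuv va vb]] := out _ Bu.
  have nwv : ~~ f w v by apply: contra nwu => fwv; apply: fT fwv _; rewrite fS.
  have -> : col w u = col w v.
    by rewrite !(colC w) (mdl _ _ _ Bu Bw _ fuv) // fS.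
  have cE := near _ Bv va vb; rewrite cE in va vb.
  rewrite [RHS]colC; apply: gallai_other_edges; rewrite ?(colC v x) ?cE.
  - exact: nfn.
  - by rewrite eq_sym nBx.
  - by rewrite eq_sym nBx.
  - by case: (sep _ _ Bw Bv nwv) => ->; rewrite eq_sym.
  - by rewrite colC.
(* By [key], edges from the component of [y] to other components have color [col x y], and edges
   from it to [x] have this color or [c]. *)
exists (col x y), c, y, z; split; rewrite ?BA //.
apply: (contra _ nyz); apply: stay => w u fyw Au nwa nwc.
have Bw := fB _ _ By fyw.
have nwz : ~~ f w z by apply: contra nyz; apply: fT.
have [ux|/(AB _ Au) Bu] := eqVneq u x.
  move: nwa nwc; rewrite ux colC => nwa nwc.
  by rewrite -(key _ _ Bw nwc Bz nwz) -(mdl _ _ _ By Bz _ fyw) // key ?eqxx in nwa.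
have [//|nyu] := boolP (f y u).
have := mdl _ _ _ By Bu nyu fyw; rewrite key // => E.
by rewrite -E eqxx in nwa.
Qed.
End GallaiColorings.

(** * Many vertices homogeneous to a common set *)

Lemma leq_card_bigcup (V I : finType) (P : {pred I}) (F : I -> {set V}) :
  #|\bigcup_(i in P) F i| <= \sum_(i in P) #|F i|.
Proof.
apply: (big_ind2 (fun (A : {set V}) n => #|A| <= n)) => //; first by rewrite cards0.
by move=> A m B n leA leB; rewrite (leq_trans (leq_card_setU A B)) ?leq_add.
Qed.

Lemma pigeonhole (V I : finType) (Z : {set V}) (P : {set I}) (f : V -> I) :
  P != set0 -> {in Z, forall z, f z \in P} ->
  exists2 i, i \in P & #|Z| <= #|P| * #|[set z in Z | f z == i]|.
Proof.
case/set0Pn=> i0 Pi0 fP; pose F i := #|[set z in Z | f z == i]|.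
have [i Pi maxi] := @arg_maxnP _ i0 (mem P) F Pi0; exists i => //.
rewrite -sum1_card (partition_big f (mem P)) //= -sum_nat_const.
apply: leq_sum => j Pj; apply: leq_trans (maxi j Pj).
by rewrite /F -sum1_card; under [leqRHS]eq_bigl do rewrite inE.
Qed.

Section HomogeneousPair.
Variables (V : finType) (K : eqType) (col : V -> V -> K).
Hypothesis colC : forall x y, col x y = col y x.
Hypothesis no_rainbow : forall x y z, x != y -> y != z -> x != z ->
  [|| col x y == col y z, col y z == col x z | col x y == col x z].

Definition homogeneous (x : V) (T : {set V}) :=
  (x \notin T) && [forall y in T, forall z in T, col x y == col x z].

Lemma homogeneousP x (T : {set V}) :
  reflect (x \notin T /\ {in T &, forall y z, col x y = col x z})
          (homogeneous x T).
Proof.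
apply: (iffP andP) => -[xT hom]; split=> //.
  by move=> y z Ty Tz; move/forall_inP: hom => /(_ y Ty)/forall_inP/(_ z Tz)/eqP.
by apply/forall_inP=> y Ty; apply/forall_inP=> z Tz; rewrite (hom y z).
Qed.

Lemma homogeneous_sub x (T T' : {set V}) :
  T' \subset T -> homogeneous x T -> homogeneous x T'.
Proof.
move=> /subsetP sT /homogeneousP[xT hom]; apply/homogeneousP; split.
  by apply: contra xT => /sT.
by move=> y z /sT Ty /sT Tz; apply: hom.
Qed.

Definition module (A : {set V}) := [forall x in ~: A, homogeneous x A].

(** Vertices outside [A] are homogeneous to all of [A]; those in other components are handled by
    [other_color_module]. *)
Lemma module_component (A : {set V}) a b x : x \in A -> module A ->
  module [set y | connect (other_color col A a b) x y].
Proof.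
move=> Ax modA; apply/forall_inP=> z; rewrite !inE => nxz.
have cA y : connect (other_color col A a b) x y -> y \in A.
  exact: other_color_connect_in.
have [Az|nAz] := boolP (z \in A); last first.
  apply: homogeneous_sub (forall_inP modA z _); last by rewrite inE.
  by apply/subsetP=> y; rewrite inE => /cA.
apply/homogeneousP; split=> [|y y']; rewrite !inE // => xy xy'.
rewrite !(colC z) -(other_color_module no_rainbow Ax Az nxz xy).
by rewrite -(other_color_module no_rainbow Ax Az nxz xy').
Qed.

(* An inclusion-minimal module A with at least 2t vertices splits, by         *)
(* Gallai's theorem, into components smaller than 2t joined by two colors     *)
(* only, and the pigeonhole principle applies to the vertices of A joined to  *)
(* 2t fixed vertices in these two colors. All vertices outside A are          *)
(* homogeneous to A for free.                                                 *)
Lemma homogeneous_pair t : 0 < t ->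
  exists S T : {set V}, [/\ S != set0 -> t <= #|T|,
    {in S, forall x, homogeneous x T} &
    #|V| <= (t.*2) ^ 2 + 2 ^ t.*2 * #|S|].
Proof.
move=> t_gt0; have t2_gt0 : 0 < t.*2 by rewrite double_gt0.
have [ltV|leV] := ltnP #|V| t.*2.
  (* The condition [S != set0] in the statement is there for this case, where no [T] of size [t]
     need exist. *)
  exists set0, set0; split; [by rewrite eqxx | by move=> x; rewrite inE |].
  by rewrite cards0 muln0 addn0 (leq_trans (ltnW ltV)) // leq_pmulr.
have [|A /minsetP[/andP[modA leA] minA] _] :=
    @minset_exists _ (fun A => module A && (t.*2 <= #|A|)) setT.
  rewrite cardsT leV andbT; apply/forall_inP=> x; by rewrite !inE.
have [|a [b [x [y [Ax Ay nxy]]]]] := @gallai_separation _ _ _ colC no_rainbow A.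
  by apply: leq_trans leA; rewrite -(ltn_predK t_gt0).
set e := other_color col A a b in nxy.
pose comp z := [set w | connect e z w].
have comp_sub z : z \in A -> comp z \subset A.
  move=> Az; apply/subsetP=> w; rewrite inE; exact: other_color_connect_in.
have small z : z \in A -> #|comp z| <= t.*2.
  move=> Az; rewrite leqNgt; apply/negP=> /ltnW lec.
  have compA : comp z = A.
    by apply: minA (comp_sub _ Az); rewrite module_component.
  have : (x \in comp z) && (y \in comp z) by rewrite compA Ax.
  rewrite !inE => /andP[zx zy]; case/negP: nxy; apply: connect_trans zy.
  by rewrite (other_color_connect_sym colC).
have [X sXA cardX] : exists2 X : {set V}, X \subset A & #|X| = t.*2.
  exists [set z in take t.*2 (enum A)].
    by apply/subsetP=> z; rewrite inE => /mem_take; rewrite mem_enum.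
  rewrite cardsE (card_uniqP _) ?take_uniq ?enum_uniq // size_takel //.
  by rewrite -cardE.
have inX z : z \in X -> z \in A by apply/subsetP.
(* The components meeting [X] account for the summand [(2t)^2]; the rest of [A] sees [X] in colors
   [a] and [b] only. *)
pose Z := A :\: \bigcup_(z in X) comp z.
have cardZ : #|A| <= t.*2 ^ 2 + #|Z|.
  rewrite -(cardsID (\bigcup_(z in X) comp z) A) leq_add2r.
  apply: leq_trans (subset_leq_card (subsetIr _ _)) _.
  apply: leq_trans (leq_card_bigcup _ _) _; rewrite expnS expn1 -{1}cardX.
  by rewrite -sum_nat_const leq_sum // => z /inX/small.
have sepZ z w : z \in Z -> w \in X -> w != z /\ (col z w = a \/ col z w = b).
  case/setDP=> Az /bigcupP nz Xw.
  have nwz : ~~ connect e w z by apply/negP=> wz; case: nz; exists w; rewrite ?inE.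
  split; first by apply: contraNneq nwz => ->.
  by rewrite colC; apply: other_color_separated (inX _ Xw) Az nwz.
(* There are [2^(2t)] possible patterns toward [X]; in the most frequent one, [a] or [b] occurs on
   at least [t] of the [2t] vertices. *)
pose f z := [set w in X | col z w == a].
have [||W] := @pigeonhole _ _ Z (powerset X) f.
- by apply/set0Pn; exists set0; rewrite powersetE sub0set.
- by move=> z _; rewrite powersetE; apply/subsetP=> w; rewrite inE => /andP[].
rewrite powersetE => sWX; rewrite card_powerset cardX => leZ.
have [T [sTX tT homT]] : exists T : {set V}, [/\ T \subset X, t <= #|T| &
    {in Z, forall z, f z = W -> {in T &, forall u v, col z u = col z v}}].
  have [leW|ltW] := leqP t #|W|.
    exists W; split=> // z Zz fz u v; rewrite -fz !inE.
    by case/andP=> _ /eqP-> /andP[_ /eqP->].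
  exists (X :\: W); split; first exact: subsetDl.
    rewrite -(leq_add2l #|W|) cardsDS // subnKC ?subset_leq_card //.
    by rewrite cardX -addnn leq_add2r ltnW.
  move=> z Zz fz u v /setDP[Xu]; rewrite -fz inE Xu /= => nua.
  case/setDP=> Xv; rewrite inE Xv /= => nva.
  case: (sepZ _ _ Zz Xu) (sepZ _ _ Zz Xv) => _ [E|->]; first by rewrite E eqxx in nua.
  by case=> _ [E|->] //; rewrite E eqxx in nva.
have inT w : w \in T -> w \in X by apply/subsetP.
set Z' := [set z in Z | f z == W] in leZ.
exists (~: A :|: Z'), T; split=> //.
  move=> z /setUP[nAz|]; last first.
    rewrite inE => /andP[Zz /eqP fz]; apply/homogeneousP; split; last exact: homT.
    by apply/negP=> /inT Xz; have [] := sepZ _ _ Zz Xz; rewrite eqxx.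
  apply: homogeneous_sub (forall_inP modA z nAz).
  exact: subset_trans sTX sXA.
have -> : #|~: A :|: Z'| = #|~: A| + #|Z'|.
  apply/eqP; rewrite (leq_card_setU _ _).2 disjoints_subset.
  apply/subsetP=> z; rewrite !inE => nAz; by rewrite (negPf nAz) andbF.
rewrite -(cardsC A) mulnDr addnCA addnC leq_add //; last first.
  by apply: leq_trans cardZ _; rewrite leq_add2l.
by rewrite leq_pmull // expn_gt0.
Qed.
End HomogeneousPair.

(** * Clique numbers and the exponential bound *)

Section CliqueNumbers.
Variables (V K : finType) (col : V -> V -> K).
Hypothesis colC : forall x y, col x y = col y x.

Definition mono_clique (a : K) (B : {set V}) :=
  [forall x in B, forall y in B, (x != y) ==> (col x y == a)].

Lemma mono_cliqueP a (B : {set V}) :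
  reflect {in B &, forall x y, x != y -> col x y = a} (mono_clique a B).
Proof.
apply: (iffP forall_inP) => [cl x y Bx By nxy | cl x Bx].
  by move/forall_inP: (cl x Bx) => /(_ y By); rewrite nxy => /eqP.
by apply/forall_inP=> y By; apply/implyP=> nxy; rewrite cl.
Qed.

Definition clique_number (a : K) (A : {set V}) :=
  \max_(B : {set V} | (B \subset A) && mono_clique a B) #|B|.

Lemma clique_number_sub a (A A' : {set V}) :
  A \subset A' -> clique_number a A <= clique_number a A'.
Proof.
move=> sAA'; apply/bigmax_leqP=> B /andP[sBA clB].
by apply: leq_bigmax_cond; rewrite clB (subset_trans sBA).
Qed.

(** Adding [x] to a clique in its neighborhood of color [a] gives a larger clique. *)
Lemma clique_number_nbhd a (A : {set V}) x : x \in A ->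
  clique_number a [set y in A | (y != x) && (col x y == a)] < clique_number a A.
Proof.
move=> Ax; set N := [set y in A | _].
have [|B /andP[sBN clB] NE] := @eq_bigmax_cond _
    [pred B : {set V} | (B \subset N) && mono_clique a B] (fun B => #|B|).
  apply/card_gt0P; exists set0; rewrite inE /= sub0set.
  by apply/mono_cliqueP=> y z; rewrite inE.
have BN y : y \in B -> [/\ y \in A, y != x & col x y = a].
  by move/(subsetP sBN); rewrite inE => /and3P[? ? /eqP].
have nBx : x \notin B by apply/negP=> /BN[_]; rewrite eqxx.
rewrite [clique_number a N]NE -[#|B|.+1]/(true + #|B|) -nBx -cardsU1.
apply: leq_bigmax_cond; rewrite subUset sub1set Ax /=.
apply/andP; split; first by apply/subsetP=> y /BN[].
apply/mono_cliqueP=> y z /setU1P[->|By] /setU1P[->|Bz]; rewrite ?eqxx //.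
- by have [] := BN _ Bz.
- by rewrite colC; have [] := BN _ By.
- exact: (mono_cliqueP _ _ clB).
Qed.

Hypothesis no_rainbow : forall x y z, x != y -> y != z -> x != z ->
  [|| col x y == col y z, col y z == col x z | col x y == col x z].

(* Two vertices x and y that are separated in colors a and b cover A by their *)
(* four neighborhoods in these colors.                                        *)
Lemma leq_card_clique_number (A : {set V}) :
  #|A| <= 4 ^ \sum_a clique_number a A.
Proof.
have [n] := ubnP #|A|; elim: n A => // n IHn A ltA.
have [leA1|ltA1] := leqP #|A| 1.
  by apply: leq_trans leA1 _; rewrite expn_gt0.
have [a [b [x [y [Ax Ay nxy]]]]] := gallai_separation colC no_rainbow ltA1.
pose N w i := [set z in A | (z != w) && (col w z == i)].
(* Passing to a neighborhood lowers the exponent by at least one, so each of the four covering sets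
   has at most a quarter of the claimed size. *)
have leN w i : w \in A -> 4 * #|N w i| <= 4 ^ \sum_a clique_number a A.
  move=> Aw; have sNA : N w i \subset A.
    by apply/subsetP=> z; rewrite inE => /andP[].
  have ltN : \sum_a clique_number a (N w i) < \sum_a clique_number a A.
    rewrite (bigD1 i) //= [X in _ < X](bigD1 i) //= -addSn leq_add //.
      exact: clique_number_nbhd.
    by apply: leq_sum => j _; apply: clique_number_sub.
  apply: (leq_trans _ (leq_pexp2l _ ltN)) => //; rewrite expnS leq_mul2l /= IHn //.
  apply: (leq_trans _ (ltA : #|A| <= n)); rewrite proper_card //.
  by rewrite /proper sNA; apply/subsetPn; exists w; rewrite // inE eqxx andbF.
have : #|A| <= (#|N x a| + #|N x b|) + (#|N y a| + #|N y b|).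
  apply: leq_trans (leq_add (leq_card_setU _ _) (leq_card_setU _ _)).
  apply: leq_trans (leq_card_setU _ _); apply/subset_leq_card/subsetP=> z Az.
  have cover w : w \in A -> ~~ connect (other_color col A a b) w z ->
      z \in N w a :|: N w b.
    move=> Aw nwz; rewrite !inE Az /= -andb_orr; apply/andP; split.
      by apply: contraNneq nwz => ->.
    by have [->|->] := other_color_separated Aw Az nwz; rewrite eqxx ?orbT.
  apply/setUP; have [xz|] := boolP (connect (other_color col A a b) x z).
    right; apply: cover => //; apply: contra nxy => yz.
    by apply: connect_trans xz _; rewrite (other_color_connect_sym colC).
  by left; apply: cover.
move=> leA; rewrite -(leq_pmul2l (isT : 0 < 4)).
apply: (leq_trans (leq_mul (leqnn 4) leA)); rewrite !mulnDr.
apply: leq_trans (leq_add (leq_add (leN x a Ax) (leN x b Ax))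
                          (leq_add (leN y a Ay) (leN y b Ay))) _.
by set m := 4 ^ _; rewrite !addnn -!muln2 -mulnA mulnC.
Qed.

End CliqueNumbers.

(** * Arrowing in terms of symmetric color functions, and the twin extension *)

Definition rainbow_free (V : Type) (K : eqType) (e : rel V)
    (col : V -> V -> K) := forall x y z, e x y -> e y z -> e x z ->
  [|| col x y == col y z, col y z == col x z | col x y == col x z].

Definition mono_free (V : Type) (K : eqType) (H : sgraph) (e : rel V)
    (col : V -> V -> K) := forall (f : H -> V) a, injective f ->
  (forall x y, adj x y -> e (f x) (f y)) ->
  ~ (forall x y, adj x y -> col (f x) (f y) = a).

Lemma set2_eq (T : finType) (x y z t : T) : [set x; y] = [set z; t] ->
  (x = z /\ y = t) \/ (x = t /\ y = z).
Proof.
move=> E; have /set2P : x \in [set z; t] by rewrite -E set21.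
have /set2P : y \in [set z; t] by rewrite -E set22.
have /set2P : z \in [set x; y] by rewrite E set21.
have /set2P : t \in [set x; y] by rewrite E set22.
by move=> [] ? [] ? [] ? [] ?; subst; auto.
Qed.

Definition vertex3_0 : complete 3 := @Ordinal 3 0 isT.
Definition vertex3_1 : complete 3 := @Ordinal 3 1 isT.
Definition vertex3_2 : complete 3 := @Ordinal 3 2 isT.

Lemma complete3_ind (P : complete 3 -> Prop) :
  P vertex3_0 -> P vertex3_1 -> P vertex3_2 -> forall i, P i.
Proof.
move=> P0 P1 P2 [[|[|[|//]]] lt].
- by rewrite (_ : Ordinal lt = vertex3_0) //; apply: val_inj.
- by rewrite (_ : Ordinal lt = vertex3_1) //; apply: val_inj.
- by rewrite (_ : Ordinal lt = vertex3_2) //; apply: val_inj.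
Qed.

Lemma not_arrows_coloring k (G H : sgraph) : ~~ gallai_arrows k G H ->
  exists col : G -> G -> 'I_k, [/\ forall x y, col x y = col y x,
    rainbow_free (@adj G) col & mono_free H (@adj G) col].
Proof.
rewrite negb_forall => /existsP[c]; rewrite negb_or => /andP[nrb nmono].
exists (fun x y => c [set x; y]); split=> [x y|x y z xy yz xz|f a f_inj f_adj fa].
- by rewrite setUC.
- apply: contraR nrb; rewrite !negb_or => /and3P[xyz yzx xyx].
  pose f : {ffun complete 3 -> G} := [ffun i => tnth [tuple x; y; z] i].
  have nxy : x != y by apply: contraTneq xy => ->; rewrite adj_irr.
  have nyz : y != z by apply: contraTneq yz => ->; rewrite adj_irr.
  have nxz : x != z by apply: contraTneq xz => ->; rewrite adj_irr.
  have f0 : f vertex3_0 = x by rewrite ffunE.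
  have f1 : f vertex3_1 = y by rewrite ffunE.
  have f2 : f vertex3_2 = z by rewrite ffunE.
  have adjC u v : @adj G u v -> @adj G v u by rewrite adj_sym.
  apply/existsP; exists f; apply/andP; split; first (apply/andP; split).
  + apply/injectiveP; apply: complete3_ind; apply: complete3_ind => //;
      by rewrite ?f0 ?f1 ?f2 => E; move: nxy nyz nxz; rewrite E eqxx.
  + apply/forallP; apply: complete3_ind; apply/forallP; apply: complete3_ind;
      by apply/implyP; rewrite ?f0 ?f1 ?f2 // => _; apply: adjC.
  (* Edges of the triangle are indexed by the opposite vertex, so that being rainbow becomes
     injectivity of [C]. *)
  pose C (l : 'I_3) := match val l with
    0 => c [set y; z] | 1 => c [set x; z] | _ => c [set x; y] end.
  have C_inj : injective C.
    apply: complete3_ind; apply: complete3_ind => //;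
    by move=> E; move: xyz yzx xyx; move: E; rewrite /C /= => ->; rewrite eqxx.
  have opposite : forall i j : complete 3, adj i j ->
      exists l, [set i; j] = [set~ l] /\ c [set f i; f j] = C l.
    have opp l (i j : complete 3) : adj i j -> l != i -> l != j ->
        c [set f i; f j] = C l ->
        exists l, [set i; j] = [set~ l] /\ c [set f i; f j] = C l.
      move=> ij li lj cl; exists l; split=> //; apply/eqP.
      rewrite eqEcard cardsC1 card_ord cards2 (ij : i != j) leqnn andbT.
      by rewrite subUset !sub1set !inE ![_ == l]eq_sym li lj.
    apply: complete3_ind; apply: complete3_ind => // _.
    - by apply: (opp vertex3_2); rewrite ?f0 ?f1 ?f2.
    - by apply: (opp vertex3_1); rewrite ?f0 ?f1 ?f2.
    - by apply: (opp vertex3_2); rewrite ?f0 ?f1 ?f2 // setUC.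
    - by apply: (opp vertex3_0); rewrite ?f0 ?f1 ?f2.
    - by apply: (opp vertex3_1); rewrite ?f0 ?f1 ?f2 // setUC.
    - by apply: (opp vertex3_0); rewrite ?f0 ?f1 ?f2 // setUC.
  apply/forallP=> i; apply/forallP=> j; apply/forallP=> r; apply/forallP=> t.
  apply/implyP=> /and3P[/opposite[l [-> ->]] /opposite[l' [-> ->]]].
  by apply: contra => /eqP/C_inj->.
- case/existsP: nmono; exists [ffun x => f x]; apply/andP; split.
    apply/andP; split; first by apply/injectiveP=> x y; rewrite !ffunE => /f_inj.
    apply/forallP=> x; apply/forallP=> y; apply/implyP; rewrite !ffunE.
    exact: f_adj.
  apply/existsP; exists a; apply/forallP=> x; apply/forallP=> y.
  by apply/implyP=> xy; rewrite !ffunE fa.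
Qed.

Lemma coloring_not_arrows k (G H : sgraph) (d : 'I_k) (col : G -> G -> 'I_k) :
  (forall x y, col x y = col y x) -> rainbow_free (@adj G) col ->
  mono_free H (@adj G) col -> ~~ gallai_arrows k G H.
Proof.
move=> colC rbf mf.
pose c : coloring k G := [ffun e : {set G} =>
  if [pick p : G * G | e == [set p.1; p.2]] is Some p then col p.1 p.2 else d].
have cE x y : c [set x; y] = col x y.
  rewrite ffunE; case: pickP => [[u v] /eqP /= /set2_eq[[-> ->]|[-> ->]]|] //.
  by move/(_ (x, y)); rewrite /= eqxx.
rewrite negb_forall; apply/existsP; exists c; rewrite negb_or.
have homP (F : sgraph) (f : {ffun F -> G}) : is_copy f ->
    injective f /\ forall x y, adj x y -> adj (f x) (f y).
  case/andP=> /injectiveP f_inj /forallP f_adj; split=> // x y.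
  exact: (implyP (forallP (f_adj x) y)).
apply/andP; split; apply/existsPn=> f; apply/negP=> /andP[/homP[f_inj f_adj]].
  move=> rb.
  have col_neq i j l : adj i j -> adj j l -> adj i l ->
      col (f i) (f j) != col (f j) (f l).
    move=> ij jl il; move/forallP: rb => /(_ i)/forallP/(_ j)/forallP/(_ j).
    move/forallP=> /(_ l); rewrite ij jl !cE => /implyP; apply=> /=.
    apply/eqP=> /set2_eq[[E _]|[E _]]; first by rewrite E adj_irr in ij.
    by rewrite E adj_irr in il.
  pose i0 := vertex3_0; pose i1 := vertex3_1; pose i2 := vertex3_2.
  have := rbf (f i0) (f i1) (f i2) (f_adj i0 i1 isT) (f_adj i1 i2 isT)
    (f_adj i0 i2 isT).
  case/or3P; apply/negP; first exact: col_neq.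
    by rewrite (colC (f i0)); apply: col_neq.
  by rewrite (colC (f i0) (f i1)); apply: col_neq.
case/existsP=> a /forallP fa; apply: (mf f a f_inj f_adj) => x y xy.
by move/forallP: (fa x) => /(_ y); rewrite xy cE => /eqP.
Qed.

(* The new vertex is a twin of the vertices of T, with edges to S only: in a  *)
(* monochromatic copy of H it can be traded for an unused vertex of T.        *)
Lemma twin_not_arrows k (H : sgraph) m (col : 'I_m -> 'I_m -> 'I_k)
    (S T : {set 'I_m}) : 0 < k -> no_isolated_vertex H -> 0 < #|H| ->
  (forall x y, col x y = col y x) -> rainbow_free (@adj (complete m)) col ->
  mono_free H (@adj (complete m)) col ->
  (S != set0 -> #|H| <= #|T|) -> {in S, forall x, homogeneous col x T} ->
  ~~ gallai_arrows k (complete_star m #|S|) H.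
Proof.
move=> k_gt0 noiso /card_gt0P[h00 _] colC rbf mf leHT homS.
pose d := Ordinal k_gt0; pose l := enum S ++ enum (~: S).
(* [complete_star] joins the new vertex to the first vertices, so [p] renumbers them with [S] in
   front. *)
pose p (i : 'I_m) := nth i l i.
have szl : size l = m by rewrite size_cat -!cardE cardsC card_ord.
have ul : uniq l.
  rewrite cat_uniq !enum_uniq andbT /=; apply/hasPn=> x.
  by rewrite !mem_enum inE.
have p_inj : injective p.
  move=> i j /eqP; rewrite /p (set_nth_default i) ?szl //.
  by rewrite nth_uniq ?szl // => /eqP/val_inj.
have pS (i : 'I_m) : i < #|S| -> p i \in S.
  by rewrite /p nth_cat -cardE => ltS; rewrite ltS -mem_enum mem_nth // -cardE.
pose att x := if [pick y in T] is Some y then col x y else d.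
have leT x : x \in S -> 0 < #|T|.
  move=> Sx; apply: leq_trans (leHT _); last by apply/set0Pn; exists x.
  by apply/card_gt0P; exists h00.
have attE x y : x \in S -> y \in T -> att x = col x y.
  move=> Sx Ty; have /homogeneousP[_ hom] := homS _ Sx.
  by rewrite /att; case: pickP => [z Tz|/(_ y)]; [apply: hom | rewrite Ty].
have nST x y : x \in S -> y \in T -> x != y.
  move=> Sx Ty; have /homogeneousP[nTx _] := homS _ Sx.
  by apply: contraNneq nTx => ->.
pose col' (u v : complete_star m #|S|) := match u, v with
  | Some i, Some j => col (p i) (p j)
  | Some i, None | None, Some i => att (p i)
  | None, None => d end.
apply: (coloring_not_arrows (col := col') d).
- by case=> [i|] [j|] //=.
(* A triangle at the new vertex is colored like one at any [y] in [T]. *)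
- have tri (i j : 'I_m) : i != j -> i < #|S| -> j < #|S| ->
      [|| col (p i) (p j) == att (p i), att (p i) == att (p j) |
          col (p i) (p j) == att (p j)].
    move=> nij /pS Si /pS Sj; have /card_gt0P[y Ty] := leT _ Si.
    have := rbf (p j) (p i) y _ (nST _ _ Si Ty) (nST _ _ Sj Ty).
    rewrite colC -(attE _ _ Si Ty) -(attE _ _ Sj Ty); apply.
    by rewrite /= /complete_rel (inj_eq p_inj) eq_sym.
  case=> [i|] [j|] [r|] //=.
  + move=> ij jr ir; apply: rbf; by rewrite /= /complete_rel (inj_eq p_inj).
  + move=> ij Sj Si; have := tri _ _ ij Si Sj.
    by case/or3P=> /eqP->; rewrite eqxx ?orbT.
  + move=> Si Sr ir; have := tri _ _ ir Si Sr.
    by case/or3P=> /eqP->; rewrite eqxx ?orbT.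
  + move=> Sj jr Sr; have := tri _ _ jr Sj Sr.
    by case/or3P=> /eqP->; rewrite eqxx ?orbT.
move=> f a f_inj f_adj fa.
have [v vP] : exists v, forall h0, f h0 = None ->
    v \in T /\ forall h i, f h = Some i -> p i != v.
  have [h0 fh0|noN] := pickP (fun h => f h == None); last first.
    move fE : (f h00) => [i|]; last by have := noN h00; rewrite fE eqxx.
    by exists i => h0 E; have := noN h0; rewrite E eqxx.
  have [h1 h01] := noiso h0; have := f_adj _ _ h01; rewrite (eqP fh0).
  case fh1 : (f h1) => [i|] //= Si; have leH := leHT _.
  have {}leH : #|H| <= #|T|.
    by apply: leHT; apply/set0Pn; exists (p i); apply: pS.
  pose U := [set odflt i (omap p (f h)) | h in [set~ h0]].
  have ltU : #|U| < #|T|.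
    apply: leq_trans leH; apply: leq_ltn_trans (leq_imset_card _ _) _.
    by rewrite cardsC1 prednK //; apply/card_gt0P; exists h0.
  have [v Tv nUv] : exists2 v, v \in T & v \notin U.
    apply/subsetPn; apply: contraL ltU => /subset_leq_card.
    by rewrite -leqNgt.
  exists v => _ _; split=> // h j fh; apply: contraNneq nUv => <-.
  apply/imsetP; exists h; last by rewrite fh.
  by rewrite !inE; apply: contraTneq fh0 => <-; rewrite fh.
pose g h := if f h is Some i then p i else v.
have fsym h h' : adj h h' -> adj h' h by rewrite adj_sym.
have gadj h h' : adj h h' -> g h != g h' /\ col (g h) (g h') = a.
  move=> hh'; have := f_adj _ _ hh'; have := fa _ _ hh'; rewrite /g.
  case fh : (f h) => [i|]; case fh' : (f h') => [j|] //= <-.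
  - by move=> ij; rewrite (inj_eq p_inj).
  - move=> /pS Si; have [Tv _] := vP _ fh'.
    by rewrite (attE _ v) // nST.
  - move=> /pS Sj; have [Tv _] := vP _ fh.
    by rewrite (attE _ v) // eq_sym nST // colC.
apply: (mf g a) => [h h'|h h' /gadj[]//|h h' /gadj[]//].
rewrite /g; case fh : (f h) => [i|]; case fh' : (f h') => [j|].
- by move=> /p_inj ij; apply: f_inj; rewrite fh fh' ij.
- by move=> E; have [_ /(_ _ _ fh)] := vP _ fh'; rewrite E eqxx.
- by move=> E; have [_ /(_ _ _ fh')] := vP _ fh; rewrite E eqxx.
- by move=> _; apply: f_inj; rewrite fh fh'.
Qed.

(** * Comparison of the two Ramsey numbers *)

Lemma gallai_ramsey_gt0 k (H : sgraph) : 0 < k -> 0 < #|H| ->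
  0 < gallai_ramsey k H.
Proof.
move=> k_gt0 /card_gt0P[h _]; rewrite /gallai_ramsey.
case: ex_minnP => -[|//] /negPn/negP arr _; case: arr.
apply: (@coloring_not_arrows _ (complete 0) _ (Ordinal k_gt0)
  (fun _ _ => Ordinal k_gt0)) => //.
by move=> f; have [] := f h.
Qed.

Lemma gallai_arrows_leq k (H : sgraph) m n : m <= n ->
  gallai_arrows k (complete m) H -> gallai_arrows k (complete n) H.
Proof.
move=> lemn; apply: (@gallai_arrows_sub _ (complete m) (complete n) _
  (widen_ord lemn)) => i j.
  by move/(congr1 val)=> E; apply: val_inj.
by apply: contra => /eqP/(congr1 val) E; apply/eqP/val_inj.
Qed.

Lemma extremal_coloring k (H : sgraph) : 0 < k -> 0 < #|H| ->
  ~~ gallai_arrows k (complete (gallai_ramsey k H).-1) H.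
Proof.
move=> k_gt0 H_gt0; have := gallai_ramsey_gt0 k_gt0 H_gt0.
rewrite /gallai_ramsey; case: ex_minnP => n _ minn n_gt0.
by apply/negP=> /minn; rewrite -ltnS prednK ?ltnn.
Qed.

Lemma ltn_gallai_ramsey k (H : sgraph) n :
  ~~ gallai_arrows k (complete n) H -> n < gallai_ramsey k H.
Proof.
rewrite /gallai_ramsey; case: ex_minnP => m arr _; rewrite ltnNge; apply: contra.
by move=> lemn; apply: gallai_arrows_leq arr.
Qed.

Lemma star_critical_leq k (H : sgraph) : 0 < k -> 0 < #|H| ->
  star_critical_gallai_ramsey k H <= (gallai_ramsey k H).-1.
Proof.
move=> k_gt0 H_gt0; rewrite /star_critical_gallai_ramsey.
case: ex_minnP => s _; apply; have := gallai_ramsey_gt0 k_gt0 H_gt0.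
rewrite /gallai_ramsey; case: ex_minnP => -[//|n] arr _ _ /=.
pose g (i : complete n.+1) : complete_star n n := unlift ord_max i.
have g_inj : injective g.
  by move=> i j; rewrite /g; case: unliftP => [u|] ->; case: unliftP => [v|] -> // [->].
apply: (gallai_arrows_sub g_inj) arr => i j ij.
have : g i != g j by rewrite (inj_eq g_inj).
by case: (g i) (g j) => [u|] [v|] //= _; rewrite ltn_ord.
Qed.

Lemma ltn_star_critical k (H : sgraph) s :
  ~~ gallai_arrows k (complete_star (gallai_ramsey k H).-1 s) H ->
  s < star_critical_gallai_ramsey k H.
Proof.
rewrite /star_critical_gallai_ramsey; case: ex_minnP => r arr _.
rewrite ltnNge; apply: contra => lers.
apply: (@gallai_arrows_sub _ (complete_star _ r) (complete_star _ s) _ id) arr => //.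
by case=> [i|] [j|] //= ltr; apply: leq_trans lers.
Qed.

(** The twin extension shows that [#|S|] is less than the star-critical number, which is therefore
    positive and absorbs the additive constant. *)
Lemma extremal_leq_star_critical k (H : sgraph) :
  0 < k -> no_isolated_vertex H -> 0 < #|H| ->
  (gallai_ramsey k H).-1 <=
    ((#|H|.*2) ^ 2 + 2 ^ #|H|.*2) * star_critical_gallai_ramsey k H.
Proof.
move=> k_gt0 noiso H_gt0; set m := _.-1.
have [col [colC rbf mf]] := not_arrows_coloring (extremal_coloring k_gt0 H_gt0).
have [S [T [leT homS leV]]] := homogeneous_pair colC rbf H_gt0.
have /ltn_star_critical ltS := twin_not_arrows k_gt0 noiso H_gt0 colC rbf mf leT homS.
rewrite card_ord in leV; apply: leq_trans leV _.
rewrite mulnDl leq_add // ?leq_mul2l ?(ltnW ltS) ?orbT //.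
by rewrite leq_pmulr // (leq_trans _ ltS).
Qed.

(** * Upper bounds on extremal colorings *)

(** A monochromatic clique on [#|H|] vertices contains [H], which bounds each of the [k] clique
    numbers. *)
Lemma extremal_exponential_leq k (H : sgraph) : 0 < k -> 0 < #|H| ->
  (gallai_ramsey k H).-1 <= (4 ^ #|H|) ^ k.
Proof.
move=> k_gt0 H_gt0; set m := _.-1.
have [col [colC rbf mf]] := not_arrows_coloring (extremal_coloring k_gt0 H_gt0).
have := leq_card_clique_number colC rbf setT.
rewrite cardsT card_ord => /leq_trans; apply.
rewrite -expnM leq_exp2l // mulnC -[X in _ <= X * _]card_ord -sum_nat_const.
apply: leq_sum => a _; apply/bigmax_leqP=> B /andP[_ /mono_cliqueP clB].
rewrite leqNgt; apply/negP=> /ltnW leB.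
have rk (h : H) : enum_rank h < #|B| by apply: leq_trans leB.
pose f (h : H) := enum_val (Ordinal (rk h)).
have f_inj : injective f by move=> h h' /enum_val_inj[/val_inj/enum_rank_inj].
have f_adj h h' : adj h h' -> f h != f h'.
  by rewrite (inj_eq f_inj); apply: contraTneq => ->; rewrite adj_irr.
apply: (mf f a f_inj) => // h h' hh'.
by apply: clB; rewrite ?enum_valP ?f_adj.
Qed.

Lemma extremal_linear_leq k (H : sgraph) : 0 < k -> 0 < #|H| -> bipartite H ->
  (gallai_ramsey k H).-1 <= (#|H|.*2) ^ 2 + 2 ^ #|H|.*2 * (k * #|H|).
Proof.
move=> k_gt0 H_gt0 [side sideP]; set m := _.-1.
have [col [colC rbf mf]] := not_arrows_coloring (extremal_coloring k_gt0 H_gt0).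
have [S [T [leT homS]]] := homogeneous_pair colC rbf H_gt0.
rewrite card_ord => leV; apply: leq_trans leV _.
rewrite leq_add2l leq_mul2l; apply/orP; right.
have [->|nS0] := eqVneq S set0; first by rewrite cards0.
have {}leT := leT nS0; have /card_gt0P[y Ty] := leq_trans H_gt0 leT.
(* By homogeneity, the color toward [y] is the color toward all of [T]; a popular color [a] then
   puts one side of [H] in [S'] and the other in [T]. *)
have [||a _] := @pigeonhole _ _ S setT (fun x => col x y).
- by apply/set0Pn; exists (Ordinal k_gt0).
- by move=> x; rewrite inE.
rewrite cardsT card_ord; set S' := [set x in S | _] => leS.
apply: leq_trans leS _; rewrite leq_mul2l; apply/orP; right.
rewrite leqNgt; apply/negP=> /ltnW leS'.
have rkS (h : H) : enum_rank h < #|S'| by apply: leq_trans leS'.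
have rkT (h : H) : enum_rank h < #|T| by apply: leq_trans leT.
pose f (h : H) := if side h then enum_val (Ordinal (rkS h)) else enum_val (Ordinal (rkT h)).
have ST x z : x \in S' -> z \in T -> x != z /\ col x z = a.
  rewrite inE => /andP[Sx /eqP <-] Tz.
  have /homogeneousP[nTx hom] := homS _ Sx; split; last exact: hom.
  by apply: contraNneq nTx => ->.
have f_adj h h' : adj h h' -> f h != f h' /\ col (f h) (f h') = a.
  move/sideP; rewrite /f; case: (side h); case: (side h') => // _.
    exact: ST (enum_valP _) (enum_valP _).
  by rewrite colC eq_sym; apply: ST (enum_valP _) (enum_valP _).
apply: (mf f a) => [h h'|h h' /f_adj[]//|h h' /f_adj[]//].
rewrite /f; case: (side h); case: (side h').
- by move/enum_val_inj=> [/val_inj/enum_rank_inj].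
- by move=> E; have [] := ST _ _ (enum_valP (Ordinal (rkS h))) (enum_valP (Ordinal (rkT h'))); rewrite E eqxx.
- by move=> E; have [] := ST _ _ (enum_valP (Ordinal (rkS h'))) (enum_valP (Ordinal (rkT h))); rewrite E eqxx.
- by move/enum_val_inj=> [/val_inj/enum_rank_inj].
Qed.

(** * Lower bounds from explicit colorings *)

Lemma leq_extremal k (H : sgraph) (W : finType) (col : W -> W -> 'I_k) :
  0 < k -> 0 < #|H| ->
  (forall x y, col x y = col y x) ->
  rainbow_free (fun x y => x != y) col -> mono_free H (fun x y => x != y) col ->
  #|W| <= (gallai_ramsey k H).-1.
Proof.
move=> k_gt0 H_gt0 colC rbf mf.
rewrite -ltnS prednK ?gallai_ramsey_gt0 //; apply: ltn_gallai_ramsey.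
apply: (@coloring_not_arrows _ (complete #|W|) _ (Ordinal k_gt0)
  (fun i j => col (enum_val i) (enum_val j))).
- by move=> i j; apply: colC.
- by move=> i j r ij jr ir; apply: rbf; rewrite (inj_eq enum_val_inj).
move=> f a f_inj f_adj; apply: (mf (fun h => enum_val (f h)) a).
  by move=> h h' /enum_val_inj/f_inj.
by move=> h h' /f_adj; rewrite (inj_eq enum_val_inj).
Qed.

(* Vertex i is joined to all later vertices in color i: every color class is *)
(* a star.                                                                    *)
Lemma linear_leq_extremal k (H : sgraph) : 0 < k -> 0 < #|H| ->
  no_isolated_vertex H -> ~ star H -> k <= (gallai_ramsey k H).-1.
Proof.
move=> k_gt0 H_gt0 noiso nstar; pose col (i j : 'I_k) := if i < j then i else j.
have colP i j : col i j = i \/ col i j = j by rewrite /col; case: ifP; auto.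
rewrite -{1}[k]card_ord; apply: (@leq_extremal _ _ _ col) => //.
- by move=> i j; rewrite /col; case: ltngtP => // E; apply: val_inj.
- move=> i j r _ _ _; rewrite /col.
  case: (ltnP i j) => ij; case: (ltnP j r) => jr; case: (ltnP i r) => ir;
    rewrite ?eqxx ?orbT //.
  + by have := leq_trans (ltn_trans ij jr) ir; rewrite ltnn.
  + by have := leq_ltn_trans (leq_trans jr ij) ir; rewrite ltnn.
move=> f a f_inj f_adj fa; apply: nstar.
(* Every edge of color [a] contains the vertex [a], so its preimage is the center of the star. *)
have [h0 fh0] : exists h0, f h0 = a.
  have /card_gt0P[h _] := H_gt0; have [h' hh'] := noiso h.
  have := fa _ _ hh'; have [->|->] := colP (f h) (f h') => E;
    by [exists h | exists h'].
have center x y : adj x y -> x = h0 \/ y = h0.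
  move=> xy; have := fa _ _ xy; rewrite -fh0.
  by have [->|->] := colP (f x) (f y) => /f_inj; auto.
exists h0 => x y; apply/idP/idP.
  move=> xy; rewrite (contraTneq _ xy) /=; last by move=> ->; rewrite adj_irr.
  by have [->|->] := center _ _ xy; rewrite eqxx ?orbT.
have h0_adj z : z != h0 -> adj z h0.
  move=> nz; have [w zw] := noiso z; have [E|<-//] := center _ _ zw.
  by rewrite E eqxx in nz.
case/andP=> nxy /orP[/eqP E|/eqP E].
  by rewrite E adj_sym h0_adj // -E eq_sym.
by rewrite E h0_adj // -E.
Qed.

(* The color of xy is the first coordinate in which x and y differ: every     *)
(* color class is bipartite.                                                  *)
Lemma exponential_leq_extremal k (H : sgraph) : 0 < k -> 0 < #|H| ->
  ~ bipartite H -> 2 ^ k <= (gallai_ramsey k H).-1.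
Proof.
move=> k_gt0 H_gt0 nbip; pose W := {ffun 'I_k -> bool}.
have -> : 2 ^ k = #|{: W}| by rewrite card_ffun card_bool card_ord.
pose differ (x y : W) (i : 'I_k) := x i != y i.
pose col (x y : W) := if [pick i | differ x y i] is Some i0
  then [arg min_(i < i0 | differ x y i) i] else Ordinal k_gt0.
have colP x y : x != y -> differ x y (col x y) /\
    forall j, differ x y j -> col x y <= j.
  move=> nxy; rewrite /col; case: pickP => [i0 di0|same].
    by case: arg_minnP.
  case/eqP: nxy; apply/ffunP=> i; exact/eqP/negbFE/same.
have colE x y i : differ x y i -> (forall j, differ x y j -> i <= j) ->
    col x y = i.
  move=> di mini; have nxy : x != y.
    by apply: contraTneq di => ->; rewrite /differ eqxx.
  have [dc minc] := colP _ _ nxy.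
  by apply/val_inj/eqP; rewrite eqn_leq minc // mini.
apply: (@leq_extremal _ _ _ col) => //.
- move=> x y; have dC : differ x y =1 differ y x.
    by move=> i; rewrite /differ eq_sym.
  have [->//|nxy] := eqVneq x y; rewrite eq_sym in nxy.
  have [dc minc] := colP _ _ nxy; apply: colE; first by rewrite dC.
  by move=> j; rewrite dC; apply: minc.
- move=> x y z nxy nyz nxz.
  have [dxy mxy] := colP _ _ nxy; have [dyz myz] := colP _ _ nyz.
  have [dxz mxz] := colP _ _ nxz.
  have dxyz i : differ x y i -> differ y z i \/ differ x z i.
    by rewrite /differ; case: (x i); case: (y i); case: (z i); auto.
  have dyzx i : differ y z i -> differ x y i \/ differ x z i.
    by rewrite /differ; case: (x i); case: (y i); case: (z i); auto.
  have dxzy i : differ x z i -> differ x y i \/ differ y z i.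
    by rewrite /differ; case: (x i); case: (y i); case: (z i); auto.
  apply/or3P; rewrite -!val_eqE /=.
  (* At the smallest of the three coordinates a second pair differs too, so its color is equally
     small. *)
  have [le1|le2|le3] : [\/ (col x y <= col y z) && (col x y <= col x z),
      (col y z <= col x y) && (col y z <= col x z) |
      (col x z <= col x y) && (col x z <= col y z)] by apply/or3P; lia.
  - have [/myz|/mxz] := dxyz _ dxy; [constructor 1 | constructor 3]; lia.
  - have [/mxy|/mxz] := dyzx _ dyz; [constructor 1 | constructor 2]; lia.
  - have [/mxy|/myz] := dxzy _ dxz; [constructor 3 | constructor 2]; lia.
move=> f a _ f_adj fa; apply: nbip; exists (fun h => f h a) => x y xy.
by have [+ _] := colP _ _ (f_adj _ _ xy); rewrite fa.
Qed.

Theorem theorem5p6 (R : realType) (H : sgraph)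
    (H_nonempty : 0 < #|vertex H|) (H_no_isolated : no_isolated_vertex H) :
  (bipartite H -> ~ star H ->
     linear_growth R (fun k : nat => star_critical_gallai_ramsey k H)) /\
  (~ bipartite H ->
     exponential_growth R (fun k : nat => star_critical_gallai_ramsey k H)).
Proof.
set t := #|vertex H| in H_nonempty.
pose C : nat := (t.*2 ^ 2 + 2 ^ t.*2); pose D : nat := (2 ^ t.*2 * t).
have C_gt0 : (0 < C%:R :> R)%R by rewrite ltr0n addn_gt0 !expn_gt0 orbT.
(* [C] is the factor lost between the extremal size and the star-critical number, so both lower
   bounds are scaled by its inverse. *)
have lower k n : (1 <= k) -> (n <= (gallai_ramsey k H).-1) ->
    (C%:R^-1 * n%:R <= (star_critical_gallai_ramsey k H)%:R :> R)%R.
  move=> k_gt0 len; rewrite ler_pdivrMl // -natrM ler_nat.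
  exact: leq_trans len (extremal_leq_star_critical _ _ _).
split=> [bip nstar | nbip].
  exists C%:R^-1%R, 0%R, D%:R%R, (t.*2 ^ 2)%:R%R; split=> [||k k_gt0].
  - by rewrite invr_gt0.
  - by rewrite ltr0n muln_gt0 expn_gt0.
  rewrite addr0 lower ?linear_leq_extremal //= -natrM -natrD ler_nat.
  apply: leq_trans (star_critical_leq _ _) _ => //.
  apply: leq_trans (extremal_linear_leq _ _ _) _ => //.
  by rewrite addnC leq_add2r /D -mulnA (mulnC t).
exists C%:R^-1%R, 2%R, 1%R, (4 ^ t)%:R%R; split=> [|||| k k_gt0].
- by rewrite invr_gt0.
- by rewrite ltr1n.
- exact: ltr01.
- by rewrite ltr1n -[1](expn0 4) ltn_exp2l.
rewrite -natrX lower ?exponential_leq_extremal //= mul1r -natrX ler_nat.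
apply: leq_trans (star_critical_leq _ _) _ => //.
exact: extremal_exponential_leq.
Qed.
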